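(* Let $d\geq 0$ be an integer, and let $z\in\mathbb{C}$ with $|z|\le R<2\pi$. Define the $[d/d]$-Padé approximant for $\psi_1(z)$ as $\mathcal{R}_{d,1}(z)=\dfrac{\mathcal{N}_{d,1}(z)}{\mathcal{D}_{d,1}(z)}$, where $$\mathcal{N}_{d,1}(z)=\frac{d!}{(2d+1)!}\sum_{i=0}^d\frac{(2d+1-i)!}{i!\,(d-i)!}(-z)^i,$$ $$\mathcal{D}_{d,1}(z)=\frac{d!}{(2d+1)!}\sum_{i=0}^d\left[\sum_{j=0}^i\frac{(2d+1-j)!\,(-1)^j}{j!\,(d-j)!\,(1+i-j)!}\right]z^i.$$ Then the following bound holds: $$\left|\psi_1(z)\,\mathcal{D}_{d,1}(z)-\mathcal{N}_{d,1}(z)\right|\leq\frac{d!}{(2d+1)!}\sum_{i=2d+1}^{+\infty}\gamma_i R^i,\qquad |z|\le R<2\pi,$$ where $$\gamma_i=\left|\sum_{m=0}^{i-2d-1}\frac{B_m\,(d+1)!}{m!\,(1+i-m)!}\binom{i-m-(d+1)}{d}\right|.$$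
   Context: $\varphi_1(z)=\sum_{k=0}^{+\infty}\frac{z^k}{(k+1)!}$ (an entire function, equal to $(e^z-1)/z$ for $z\neq 0$), and $\psi_1(z)=1/\varphi_1(z)$, i.e. $\psi_1(z)=\frac{z}{e^z-1}$ for $0<|z|<2\pi$ and $\psi_1(0)=1$. $B_m$ denotes the $m$-th Bernoulli number, with the convention given by $\frac{z}{e^z-1}=\sum_{j=0}^{+\infty}B_j\frac{z^j}{j!}$ for $|z|<2\pi$ (so $B_0=1$, $B_1=-\tfrac12$). *)

(* Defs.v *)
From Stdlib Require Import Reals Factorial Binomial ClassicalEpsilon.
From Coquelicot Require Import Coquelicot.
Open Scope R_scope.

(* As for Coquelicot's RInt, the value is meaningful only for convergent series. *)
Definition CSeries (a : nat -> C) : C :=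
  @iota C_CompleteNormedModule (@is_series C_AbsRing C_NormedModule a).

Definition phi1 (z : C) : C :=
  CSeries (fun k => (z ^ k / RtoC (INR (fact (k + 1))))%C).

Definition psi1 (z : C) : C := (1 / phi1 z)%C.

(* [psi1 z] is z / (e^z - 1), with its removable singularity at 0 filled in. *)
Definition is_bernoulli (B : nat -> R) : Prop :=
  forall z : C, Cmod z < 2 * PI ->
    @is_series C_AbsRing C_NormedModule
      (fun j => (RtoC (B j) * (z ^ j / RtoC (INR (fact j))))%C) (psi1 z).

(* The Bernoulli numbers are real and determined by their generating function. *)
Definition bernoulli : nat -> R :=
  epsilon (inhabits (fun _ : nat => 0)) is_bernoulli.

(* [sum_n a n] is a 0 + ... + a n (n + 1 terms). *)
Definition pade_num (d : nat) (z : C) : C :=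
  (RtoC (INR (fact d) / INR (fact (2 * d + 1)))
   * sum_n (fun i : nat =>
       RtoC (INR (fact (2 * d + 1 - i)) / (INR (fact i) * INR (fact (d - i))))
       * (- z) ^ i) d)%C.

Definition pade_den_coef (d i : nat) : R :=
  sum_n (fun j : nat =>
    INR (fact (2 * d + 1 - j)) * (-1) ^ j
    / (INR (fact j) * INR (fact (d - j)) * INR (fact (1 + i - j)))) i.

Definition pade_den (d : nat) (z : C) : C :=
  (RtoC (INR (fact d) / INR (fact (2 * d + 1)))
   * sum_n (fun i : nat => RtoC (pade_den_coef d i) * z ^ i) d)%C.

Definition pade (d : nat) (z : C) : C := (pade_num d z / pade_den d z)%C.

(* Used only for i >= 2 d + 1, where no natural-number subtraction truncates.
   [Binomial.C] is the binomial coefficient; Coquelicot's [C] is the complex field. *)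
Definition gamma (d i : nat) : R :=
  Rabs (sum_n (fun m : nat =>
    bernoulli m * INR (fact (d + 1)) / (INR (fact m) * INR (fact (1 + i - m)))
    * Binomial.C (i - m - (d + 1)) d) (i - 2 * d - 1)).

(* Main.v *)
Require Import Defs.
From Stdlib Require Import Reals Factorial Lra Lia ClassicalEpsilon.
From Coquelicot Require Import Coquelicot.
Open Scope R_scope.

(** Write [N], [D] for the two Padé polynomials without their common factor
    [d! / (2 d + 1)!].  The denominator is built so that [D] is the truncation of
    [N phi1] at degree [d]; put [E = N phi1 - D].  Since [psi1 phi1 = 1],
    [psi1 D - N = - psi1 E].  For [i > d] the coefficient of [z^i] in [N phi1] is,
    up to the factor [(d+1)! / (i+1)!], the coefficient of [t^d] in
    [(1 - t)^(i+1) (1 - t)^-(d+2) = (1 - t)^(i-d-1)], that is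
    [(-1)^d binom (i-d-1) d] ([PS_mult_num_phi1_high]).  It vanishes for
    [d < i <= 2 d], so [psi1 E] starts in degree [2 d + 1], and the moduli of its
    coefficients are the [gamma d i].  Bounding the series term by term gives the
    estimate ([pade_remainder] and [Cmod_le_Series]).

    The analytic content is that the power series of [psi1] converges absolutely
    on the whole disk [|z| < 2 pi].  The functions [P_n = B_n(x) / n!] satisfy
    [P_{n+1}' = P_n], and the odd ones with index at least 3 vanish at [0] and
    [1/2].  The function [sin (2 pi x)] vanishes at the same two points, and two
    antidifferentiations divide it by [(2 pi)^2], up to sign.  Comparing the two by
    concavity yields [|P_{2k+3}| <= sin (2 pi x) / (2 pi)^{2k}] on [[0, 1/2]], and
    the slopes at [0] bound [P_{2k+2}(0)] ([bernoulli_poly_bound]).  So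
    [P_n(0) = O((2 pi)^-n)].  Taylor's formula for [P_{n+1}] between [0] and [1]
    says that the series with coefficients [P_n(0)] is the formal inverse of
    [phi1], hence its actual inverse on the disk ([bernoulli_series]). *)

Set Bullet Behavior "Strict Subproofs".

(** * Bernoulli polynomials *)

(** The comparison principle behind the bounds on the Bernoulli polynomials.  The
    slope at [0] is part of the conclusion because the Bernoulli numbers of even
    index are the slopes at [0] of the polynomials of odd index. *)
Lemma concave_nonneg (f f1 f2 : R -> R) (a : R) :
  0 < a ->
  (forall x, is_derive f x (f1 x)) -> (forall x, is_derive f1 x (f2 x)) ->
  (forall x, 0 <= x <= a -> f2 x <= 0) ->
  f 0 = 0 -> f a = 0 ->
  (forall x, 0 <= x <= a -> 0 <= f x) /\ 0 <= f1 0.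
Proof.
intros Ha Hf Hf1 Hf2 Hf0 Hfa.
assert (MVT : forall g g' : R -> R, (forall x, is_derive g x (g' x)) ->
  forall u v, u < v -> exists c, u <= c <= v /\ g v - g u = g' c * (v - u)).
{ intros g g' Hg u v Huv.
  destruct (MVT_gen g u v g') as [c [Hc E]].
  - intros; apply Hg.
  - intros x _; apply continuity_pt_filterlim.
    apply (ex_derive_continuous g x); eexists; apply Hg.
  - rewrite Rmin_left, Rmax_right in Hc by lra. now exists c. }
assert (Hdec : forall u v, 0 <= u -> u <= v -> v <= a -> f1 v <= f1 u).
{ intros u v Hu [Huv | <-] Hv; [ | lra].
  destruct (MVT _ _ Hf1 u v Huv) as [c [Hc E]].
  assert (H := Hf2 c ltac:(lra)). nra. }
split.
- intros x Hx.
  destruct (Req_dec x 0) as [-> | H0]; [lra | ].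
  destruct (Req_dec x a) as [-> | Ha1]; [lra | ].
  assert (Hx0 : 0 < x) by lra. assert (Hxa : x < a) by lra.
  destruct (MVT _ _ Hf 0 x Hx0) as [c1 [Hc1 E1]].
  destruct (MVT _ _ Hf x a Hxa) as [c2 [Hc2 E2]].
  assert (H := Hdec c1 c2 ltac:(lra) ltac:(lra) ltac:(lra)).
  destruct (Rle_or_lt 0 (f x)) as [|Hneg]; [assumption | exfalso].
  rewrite Hf0, !Rminus_0_r in E1. rewrite Hfa in E2.
  assert (f1 c1 < 0) by nra. assert (0 < f1 c2) by nra. lra.
- destruct (MVT _ _ Hf 0 a Ha) as [c [Hc E]].
  assert (H := Hdec 0 c ltac:(lra) ltac:(lra) ltac:(lra)).
  rewrite Hf0, Hfa in E. assert (Hc0 : f1 c * a = 0) by lra.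
  destruct (Rmult_integral _ _ Hc0); lra.
Qed.

(** The normalised polynomial [B_n(x) / n!]: each is the primitive of the previous
    one whose mean over [[0, 1]] is zero. *)
Fixpoint bernoulli_poly (n : nat) : R -> R :=
  match n with
  | O => fun _ => 1
  | S m => fun x => RInt (bernoulli_poly m) 0 x
                    - RInt (fun t => RInt (bernoulli_poly m) 0 t) 0 1
  end.

Lemma is_derive_RInt_continuous (f : R -> R) :
  (forall x, continuous f x) ->
  forall x, is_derive (fun t => RInt f 0 t) x (f x).
Proof.
intros Hf x. apply (is_derive_RInt f (fun t => RInt f 0 t) 0 x); [ | apply Hf].
apply filter_forall; intros y. apply (RInt_correct f).
apply (ex_RInt_continuous f); intros; apply Hf.
Qed.

Lemma bernoulli_poly_continuous n x : continuous (bernoulli_poly n) x.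
Proof.
revert x; induction n as [|n IH]; intros x; [apply continuous_const | ].
apply (continuous_minus (V := R_NormedModule)); [ | apply continuous_const].
apply (ex_derive_continuous (fun t => RInt (bernoulli_poly n) 0 t)).
eexists. now apply is_derive_RInt_continuous.
Qed.

Lemma is_derive_bernoulli_poly n x :
  is_derive (bernoulli_poly (S n)) x (bernoulli_poly n x).
Proof.
replace (bernoulli_poly n x) with (minus (bernoulli_poly n x) zero)
  by apply minus_zero_r.
apply (is_derive_minus (fun t => RInt (bernoulli_poly n) 0 t)
         (fun _ => RInt (fun t => RInt (bernoulli_poly n) 0 t) 0 1)).
- apply is_derive_RInt_continuous, bernoulli_poly_continuous.
- apply (is_derive_const (K := R_AbsRing) (V := R_NormedModule)).
Qed.

Lemma RInt_bernoulli_poly n : RInt (bernoulli_poly (S n)) 0 1 = 0.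
Proof.
assert (H : forall x, ex_RInt (fun t => RInt (bernoulli_poly n) 0 t) 0 x).
{ intros x. apply (ex_RInt_continuous (fun t => RInt (bernoulli_poly n) 0 t)).
  intros t _. apply (ex_derive_continuous (fun t => RInt (bernoulli_poly n) 0 t)).
  eexists. apply is_derive_RInt_continuous, bernoulli_poly_continuous. }
simpl. rewrite (RInt_minus (V := R_CompleteNormedModule)
  (fun t => RInt (bernoulli_poly n) 0 t)); [ | apply H | apply ex_RInt_const].
rewrite RInt_const. unfold minus, plus, opp, scal; simpl; unfold mult; simpl. ring.
Qed.

(** The mean over [[0, 1]] of one polynomial is the difference of the end values of
    the next. *)
Lemma bernoulli_poly_jump n :
  bernoulli_poly (S n) 1 - bernoulli_poly (S n) 0
  = match n with O => 1 | S _ => 0 end.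
Proof.
transitivity (RInt (bernoulli_poly n) 0 1).
- symmetry. apply is_RInt_unique.
  apply (is_RInt_derive (bernoulli_poly (S n))); intros.
  + apply is_derive_bernoulli_poly.
  + apply bernoulli_poly_continuous.
- destruct n; [ | apply RInt_bernoulli_poly].
  simpl. rewrite RInt_const. unfold scal; simpl; unfold mult; simpl. ring.
Qed.

(** The defect of symmetry in degree [n + 1] is constant by induction, and it is up
    to sign the derivative of the defect in degree [n + 2], which has equal values
    at [0] and [1] because the polynomial does; so the constant is [0]. *)
Lemma bernoulli_poly_sym n x :
  bernoulli_poly n (1 - x) = (-1) ^ n * bernoulli_poly n x.
Proof.
revert x; induction n as [|n IH]; intros x; [simpl; ring | ].
set (defect := fun m x => bernoulli_poly m (1 - x) - (-1) ^ m * bernoulli_poly m x).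
assert (Hd : forall m x, is_derive (defect (S m)) x (- defect m x)).
{ intros m y. unfold defect.
  auto_derive.
  - repeat split; eexists; apply is_derive_bernoulli_poly.
  - assert (Hdv : forall u,
      Derive (fun x0 : R => bernoulli_poly (S m) x0) u = bernoulli_poly m u)
      by (intros; apply is_derive_unique, is_derive_bernoulli_poly).
    rewrite !Hdv. unfold Rminus; simpl; ring. }
assert (Hconst : forall u v, defect (S n) u = defect (S n) v).
{ assert (Hlt : forall u v, u < v -> defect (S n) u = defect (S n) v).
  { intros u v Huv. apply (eq_is_derive (V := R_NormedModule)); [ | exact Huv].
    intros t _. assert (E0 : defect n t = 0) by (unfold defect; rewrite IH; ring).
    assert (Ht := Hd n t). rewrite E0, Ropp_0 in Ht. exact Ht. }
  intros u v. destruct (Rtotal_order u v) as [H | [-> | H]]; auto.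
  symmetry; auto. }
destruct (MVT_gen (defect (S (S n))) 0 1 (fun y => - defect (S n) y)) as [c [_ Hc]].
- intros; apply Hd.
- intros y _; apply continuity_pt_filterlim.
  apply (ex_derive_continuous (defect (S (S n))) y); eexists; apply Hd.
- assert (J := bernoulli_poly_jump (S n)).
  assert (H0 : defect (S (S n)) 1 - defect (S (S n)) 0 = 0).
  { unfold defect. replace (1 - 1) with 0 by ring. replace (1 - 0) with 1 by ring.
    cbv beta iota in J.
    transitivity (- (1 + (-1) ^ S (S n))
      * (bernoulli_poly (S (S n)) 1 - bernoulli_poly (S (S n)) 0)); [ring | ].
    rewrite J; ring. }
  assert (E : defect (S n) x = 0) by (rewrite (Hconst x c); lra).
  unfold defect in E; lra.
Qed.

(** The symmetry makes an odd polynomial antisymmetric about [1/2]; together with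
    periodicity at the end points this also kills the value at [0]. *)
Lemma bernoulli_poly_odd_zeros k :
  bernoulli_poly (2 * k + 3) 0 = 0 /\ bernoulli_poly (2 * k + 3) (1 / 2) = 0.
Proof.
assert (Hs : forall x, bernoulli_poly (2 * k + 3) (1 - x) = - bernoulli_poly (2 * k + 3) x).
{ intros x. rewrite bernoulli_poly_sym, pow_add, pow_1_even. ring. }
assert (J := bernoulli_poly_jump (2 * k + 2)).
replace (S (2 * k + 2)) with (2 * k + 3)%nat in J by lia.
replace (2 * k + 2)%nat with (S (2 * k + 1)) in J by lia. cbv beta iota in J.
assert (H0 := Hs 0). assert (H1 := Hs (1 / 2)).
replace (1 - 0) with 1 in H0 by ring.
replace (1 - 1 / 2) with (1 / 2) in H1 by field.
lra.
Qed.

Lemma bernoulli_poly_1 x : bernoulli_poly 1 x = x - 1 / 2.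
Proof.
assert (H : forall y, bernoulli_poly 1 y = y + bernoulli_poly 1 0).
{ intros y. simpl. rewrite !RInt_const. unfold scal; simpl; unfold mult; simpl. ring. }
assert (J := bernoulli_poly_sym 1 0). replace (1 - 0) with 1 in J by ring.
rewrite (H 1) in J. rewrite H. simpl ((-1) ^ 1) in J. lra.
Qed.

(** Starts the induction of [bernoulli_poly_bound]: [bernoulli_poly 1] does not
    vanish at [0], so the comparison with a sine can only begin with
    [bernoulli_poly 3], which a parabola dominates. *)
Lemma sin_2PI_lower x : 0 <= x <= 1 / 2 -> x * (1 / 2 - x) <= sin (2 * PI * x).
Proof.
assert (HPI := PI_RGT_0).
assert (J : forall y, 0 <= y <= 1 / 4 -> 4 * y <= sin (2 * PI * y)).
{ destruct (concave_nonneg (fun y => sin (2 * PI * y) - 4 * y)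
    (fun y => 2 * PI * cos (2 * PI * y) - 4)
    (fun y => - (2 * PI) ^ 2 * sin (2 * PI * y)) (1 / 4)) as [H _].
  - lra.
  - intros y. auto_derive; [easy | ring].
  - intros y. auto_derive; [easy | ring].
  - intros y Hy. assert (0 <= sin (2 * PI * y)) by (apply sin_ge_0; nra).
    assert (0 <= (2 * PI) ^ 2) by (apply pow_le; lra). nra.
  - rewrite Rmult_0_r, sin_0; ring.
  - replace (2 * PI * (1 / 4)) with (PI / 2) by field. rewrite sin_PI2; field.
  - intros y Hy. specialize (H y Hy). simpl in H. lra. }
(* [J] is Jordan's inequality; the other half of the interval follows from
   the symmetry of the sine about [pi / 2]. *)
intros Hx. destruct (Rle_or_lt x (1 / 4)) as [Hx4 | Hx4].
- assert (H := J x ltac:(lra)). nra.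
- assert (H := J (1 / 2 - x) ltac:(lra)).
  replace (2 * PI * (1 / 2 - x)) with (PI - 2 * PI * x) in H by field.
  rewrite sin_PI_x in H. nra.
Qed.

(** With [g] the claimed bound, [g - P] and [g + P] vanish at [0] and [1/2], and the
    bound two degrees lower says that both are concave.  The constant [1] is generous;
    only the geometric rate [1 / (2 pi)] matters for the radius of convergence. *)
Lemma bernoulli_poly_bound k :
  (forall x, 0 <= x <= 1 / 2 ->
     Rabs (bernoulli_poly (2 * k + 3) x) <= sin (2 * PI * x) / (2 * PI) ^ (2 * k))
  /\ Rabs (bernoulli_poly (2 * k + 2) 0) <= 2 * PI / (2 * PI) ^ (2 * k).
Proof.
assert (HPI := PI_RGT_0).
assert (Hp : 0 < 2 * PI) by lra.
assert (Hcmp : forall (m : nat) (g g1 g2 : R -> R),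
  (forall x, is_derive g x (g1 x)) -> (forall x, is_derive g1 x (g2 x)) ->
  g 0 = 0 -> g (1 / 2) = 0 ->
  (forall x, 0 <= x <= 1 / 2 -> Rabs (bernoulli_poly (2 * m + 1) x) <= - g2 x) ->
  (forall x, 0 <= x <= 1 / 2 -> Rabs (bernoulli_poly (2 * m + 3) x) <= g x)
  /\ Rabs (bernoulli_poly (2 * m + 2) 0) <= g1 0).
{ intros m g g1 g2 Hg Hg1 Hg0 Hga Hle.
  destruct (bernoulli_poly_odd_zeros m) as [Z0 Z1].
  assert (D1 : forall x, is_derive (bernoulli_poly (2 * m + 3)) x (bernoulli_poly (2 * m + 2) x)).
  { intros x. replace (2 * m + 3)%nat with (S (2 * m + 2)) by lia.
    apply is_derive_bernoulli_poly. }
  assert (D2 : forall x, is_derive (bernoulli_poly (2 * m + 2)) x (bernoulli_poly (2 * m + 1) x)).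
  { intros x. replace (2 * m + 2)%nat with (S (2 * m + 1)) by lia.
    apply is_derive_bernoulli_poly. }
  destruct (concave_nonneg (fun x => g x - bernoulli_poly (2 * m + 3) x)
    (fun x => g1 x - bernoulli_poly (2 * m + 2) x)
    (fun x => g2 x - bernoulli_poly (2 * m + 1) x) (1 / 2)) as [Hm Hm0]; try lra.
  { intros x. apply (is_derive_minus g); auto. }
  { intros x. apply (is_derive_minus g1); auto. }
  { intros x Hx. specialize (Hle x Hx). apply Rabs_le_between in Hle. lra. }
  destruct (concave_nonneg (fun x => g x + bernoulli_poly (2 * m + 3) x)
    (fun x => g1 x + bernoulli_poly (2 * m + 2) x)
    (fun x => g2 x + bernoulli_poly (2 * m + 1) x) (1 / 2)) as [Hq Hq0]; try lra.
  { intros x. apply (is_derive_plus g); auto. }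
  { intros x. apply (is_derive_plus g1); auto. }
  { intros x Hx. specialize (Hle x Hx). apply Rabs_le_between in Hle. lra. }
  split; [intros x Hx | ]; apply Rabs_le_between; [ | lra].
  specialize (Hm x Hx); specialize (Hq x Hx); cbv beta in Hm, Hq; lra. }
induction k as [|k [IH _]].
- (* The parabola has second derivative [-1/2], and [|x - 1/2| <= 1/2]. *)
  destruct (Hcmp O (fun x => 1 / 4 * x * (1 / 2 - x)) (fun x => 1 / 8 - 1 / 2 * x)
    (fun _ => - (1 / 2))) as [H1 H2].
  + intros x. auto_derive; [easy | field].
  + intros x. auto_derive; [easy | field].
  + ring.
  + field.
  + intros x Hx. simpl (2 * 0 + 1)%nat. rewrite bernoulli_poly_1.
    apply Rabs_le_between; lra.
  + simpl ((2 * PI) ^ (2 * 0)). rewrite !Rdiv_1_r. split.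
    * intros x Hx. apply (Rle_trans _ _ _ (H1 x Hx)).
      assert (Hs := sin_2PI_lower x Hx). nra.
    * apply (Rle_trans _ _ _ H2). assert (Hpi := PI2_3_2). lra.
- replace ((2 * PI) ^ (2 * S k)) with ((2 * PI) ^ 2 * (2 * PI) ^ (2 * k))
    by (rewrite <- pow_add; f_equal; lia).
  assert (Hq : (2 * PI) ^ (2 * k) <> 0) by (apply pow_nonzero; lra).
  set (q := (2 * PI) ^ (2 * k)) in *; clearbody q.
  destruct (Hcmp (S k) (fun x => sin (2 * PI * x) / ((2 * PI) ^ 2 * q))
     (fun x => 2 * PI * cos (2 * PI * x) / ((2 * PI) ^ 2 * q))
     (fun x => - (sin (2 * PI * x) / q))) as [H1 H2].
  + intros x. auto_derive; [easy | field; lra].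
  + intros x. auto_derive; [easy | field; lra].
  + rewrite Rmult_0_r, sin_0. field; lra.
  + replace (2 * PI * (1 / 2)) with PI by field. rewrite sin_PI. field; lra.
  + intros x Hx. rewrite Ropp_involutive.
    replace (2 * S k + 1)%nat with (2 * k + 3)%nat by lia. now apply IH.
  + split; [exact H1 | ].
    rewrite Rmult_0_r, cos_0, Rmult_1_r in H2. exact H2.
Qed.

Lemma bernoulli_poly_0_bounded :
  exists M, forall n, Rabs (bernoulli_poly n 0 * (2 * PI) ^ n) <= M.
Proof.
assert (HPI := PI_RGT_0).
exists (1 + PI + (2 * PI) ^ 3). intros n.
assert (H3 : 0 < (2 * PI) ^ 3) by (apply pow_lt; lra).
destruct n as [|[|n]].
- simpl (bernoulli_poly 0 0 * _). rewrite Rabs_pos_eq; lra.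
- rewrite bernoulli_poly_1, pow_1.
  apply Rabs_le_between; lra.
- destruct (Nat.Even_or_Odd n) as [[k ->] | [k ->]].
  + destruct (bernoulli_poly_bound k) as [_ H].
    replace (S (S (2 * k))) with (2 * k + 2)%nat by lia.
    assert (Hk : 0 < (2 * PI) ^ (2 * k)) by (apply pow_lt; lra).
    rewrite Rabs_mult, (Rabs_pos_eq ((2 * PI) ^ _)) by (apply pow_le; lra).
    rewrite pow_add.
    apply (Rle_trans _ (2 * PI / (2 * PI) ^ (2 * k) * ((2 * PI) ^ (2 * k) * (2 * PI) ^ 2))).
    * apply Rmult_le_compat_r; [ | exact H].
      apply Rmult_le_pos; apply pow_le; lra.
    * replace (2 * PI / (2 * PI) ^ (2 * k) * ((2 * PI) ^ (2 * k) * (2 * PI) ^ 2))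
        with ((2 * PI) ^ 3) by (field; lra). lra.
  + replace (S (S (2 * k + 1))) with (2 * k + 3)%nat by lia.
    destruct (bernoulli_poly_odd_zeros k) as [-> _].
    rewrite Rmult_0_l, Rabs_R0. lra.
Qed.

Lemma Derive_n_bernoulli_poly k n x :
  Derive_n (bernoulli_poly (n + k)) k x = bernoulli_poly n x.
Proof.
revert n x; induction k as [|k IH]; intros n x.
- now rewrite Nat.add_0_r.
- simpl. rewrite (Derive_ext _ (bernoulli_poly (S n))).
  + apply is_derive_unique, is_derive_bernoulli_poly.
  + intros t. rewrite <- IH. do 2 f_equal. lia.
Qed.

Lemma ex_derive_n_bernoulli_poly n k x :
  (k <= n)%nat -> ex_derive_n (bernoulli_poly n) k x.
Proof.
destruct k as [|k]; [easy | intros Hk; simpl].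
apply (ex_derive_ext (bernoulli_poly (S (n - S k)))).
- intros t. rewrite <- (Derive_n_bernoulli_poly k). do 2 f_equal. lia.
- eexists; apply is_derive_bernoulli_poly.
Qed.

Definition phi1_coef (k : nat) : R := / INR (fact (k + 1)).

(** Taylor's formula between [0] and [1] for the polynomial of degree [n + 1], whose
    derivatives at [0] are the lower Bernoulli coefficients: its terms of positive
    order sum to the jump of that polynomial. *)
Lemma PS_mult_phi1_bernoulli n :
  PS_mult phi1_coef (fun k => bernoulli_poly k 0) n = match n with O => 1 | S _ => 0 end.
Proof.
rewrite <- bernoulli_poly_jump.
assert (Htop : forall t, Derive_n (bernoulli_poly (S n)) (S (S n)) t = 0).
{ intros t. change (Derive (Derive_n (bernoulli_poly (S n)) (S n)) t = 0).
  rewrite (Derive_ext _ (fun _ => 1)); [apply Derive_const | ].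
  intros u. exact (Derive_n_bernoulli_poly (S n) 0 u). }
destruct (Taylor_Lagrange (bernoulli_poly (S n)) (S n) 0 1) as [c [_ E]].
- lra.
- intros t _ k Hk. destruct (Nat.eq_dec k (S (S n))) as [-> | Hne].
  + change (ex_derive (Derive_n (bernoulli_poly (S n)) (S n)) t).
    apply (ex_derive_ext (fun _ => 1)); [ | apply ex_derive_const].
    intros u. symmetry. exact (Derive_n_bernoulli_poly (S n) 0 u).
  + apply ex_derive_n_bernoulli_poly; lia.
- rewrite Htop, Rmult_0_r, Rplus_0_r, decomp_sum, Rminus_0_r in E by lia.
  simpl Init.Nat.pred in E.
  change (Derive_n (bernoulli_poly (S n)) 0 0) with (bernoulli_poly (S n) 0) in E.
  rewrite E. change (1 ^ 0 / INR (fact 0)) with (1 / 1).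
  match goal with |- _ = _ + ?v - _ => transitivity v; [ | field] end.
  apply sum_eq; intros i Hi. rewrite pow1. unfold phi1_coef.
  replace (i + 1)%nat with (S i) by lia.
  rewrite <- (Derive_n_bernoulli_poly (S i)).
  replace (n - i + S i)%nat with (S n) by lia.
  unfold Rdiv; ring.
Qed.

(** * Complex power series with real coefficients *)

Notation is_Cseries := (@is_series C_AbsRing C_NormedModule).

Lemma Re_sum_n (u : nat -> C) n : Re (sum_n u n) = sum_n (fun k => Re (u k)) n.
Proof.
induction n as [|n IH]; [now rewrite !sum_O | rewrite !sum_Sn, <- IH; reflexivity].
Qed.

Lemma Im_sum_n (u : nat -> C) n : Im (sum_n u n) = sum_n (fun k => Im (u k)) n.
Proof.
induction n as [|n IH]; [now rewrite !sum_O | rewrite !sum_Sn, <- IH; reflexivity].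
Qed.

(** Neighbourhoods in the complex field are products, so convergence can be tested
    on real and imaginary parts; this transports the real Cauchy product below. *)
Lemma is_Cseries_Re_Im (u : nat -> C) (l : C) :
  is_Cseries u l <->
  is_series (fun n => Re (u n)) (Re l) /\ is_series (fun n => Im (u n)) (Im l).
Proof.
assert (HC : is_Cseries u l <->
  forall eps : posreal, eventually (fun n => ball l eps (sum_n u n)))
  by exact (filterlim_locally (sum_n u) l).
assert (HR : forall (f : nat -> R) (x : R), is_series f x <->
  forall eps : posreal, eventually (fun n => ball x eps (sum_n f n)))
  by (intros f x; exact (filterlim_locally (sum_n f) x)).
rewrite HC, !HR. split.
- intros H; split; intros eps; generalize (H eps); apply filter_imp; intros n [H1 H2].
  + rewrite <- Re_sum_n. exact H1.
  + rewrite <- Im_sum_n. exact H2.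
- intros [H1 H2] eps. generalize (filter_and _ _ (H1 eps) (H2 eps)).
  apply filter_imp; intros n. rewrite <- Re_sum_n, <- Im_sum_n. exact (fun H => H).
Qed.

Lemma is_Cseries_unique (u : nat -> C) (l1 l2 : C) :
  is_Cseries u l1 -> is_Cseries u l2 -> l1 = l2.
Proof. apply filterlim_locally_unique. Qed.

Lemma CSeries_unique (u : nat -> C) (l : C) : is_Cseries u l -> CSeries u = l.
Proof.
intros H. apply (iota_unique (V := C_CompleteNormedModule)); [ | exact H].
intros y Hy. exact (is_Cseries_unique u y l Hy H).
Qed.

Lemma ex_Cseries_Cmod (u : nat -> C) :
  ex_series (fun n => Cmod (u n)) -> exists l, is_Cseries u l.
Proof.
apply (ex_series_le (V := C_CompleteNormedModule)). intros n. apply Rle_refl.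
Qed.

Lemma Cmod_le_Series (u : nat -> C) (l : C) (v : nat -> R) :
  is_Cseries u l -> ex_series v -> (forall n, Cmod (u n) <= v n) -> Cmod l <= Series v.
Proof.
intros Hu Hv Huv.
apply (is_lim_seq_le (fun n => Cmod (sum_n u n)) (sum_n v) (Cmod l) (Series v)).
- intros n. induction n as [|n IH]; [rewrite !sum_O; apply Huv | rewrite !sum_Sn].
  apply (Rle_trans _ _ _ (Cmod_triangle _ _)).
  now apply Rplus_le_compat.
- exact (filterlim_comp _ _ _ _ _ _ _ _ Hu (filterlim_norm (V := C_NormedModule) l)).
- exact (Series_correct v Hv).
Qed.

(** Mertens for absolutely convergent complex series, from four real products. *)
Lemma is_Cseries_mult (u v : nat -> C) (lu lv : C) :
  is_Cseries u lu -> is_Cseries v lv ->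
  ex_series (fun n => Cmod (u n)) -> ex_series (fun n => Cmod (v n)) ->
  is_Cseries (fun n => sum_n (fun k => (u k * v (n - k)%nat)%C) n) (lu * lv)%C.
Proof.
intros Hu Hv Au Av.
apply is_Cseries_Re_Im in Hu as [Hu1 Hu2]. apply is_Cseries_Re_Im in Hv as [Hv1 Hv2].
assert (Habs : forall w : nat -> C, ex_series (fun n => Cmod (w n)) ->
  ex_series (fun n => Rabs (Re (w n))) /\ ex_series (fun n => Rabs (Im (w n)))).
{ intros w Hw. split; refine (ex_series_le _ _ _ Hw); intros n;
    unfold norm; simpl; unfold abs; simpl; rewrite Rabs_Rabsolu;
    refine (Rle_trans _ _ _ _ (Rmax_Cmod (w n))); [apply Rmax_l | apply Rmax_r]. }
destruct (Habs u Au) as [Au1 Au2]. destruct (Habs v Av) as [Av1 Av2].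
apply is_Cseries_Re_Im. split.
- refine (is_series_ext _ _ _ _ (is_series_minus _ _ _ _
    (is_series_mult _ _ _ _ Hu1 Hv1 Au1 Av1) (is_series_mult _ _ _ _ Hu2 Hv2 Au2 Av2))).
  intros n. rewrite Re_sum_n, sum_n_Reals.
  symmetry. exact (minus_sum _ _ n).
- refine (is_series_ext _ _ _ _ (is_series_plus _ _ _ _
    (is_series_mult _ _ _ _ Hu1 Hv2 Au1 Av2) (is_series_mult _ _ _ _ Hu2 Hv1 Au2 Av1))).
  intros n. rewrite Im_sum_n, sum_n_Reals.
  symmetry. exact (sum_plus _ _ n).
Qed.

Lemma is_series_eventually_0 {K : AbsRing} {V : NormedModule K} (u : nat -> V) (d : nat) :
  (forall n, (d < n)%nat -> u n = zero) -> is_series u (sum_n u d).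
Proof.
intros H. apply (filterlim_ext_loc (fun _ => sum_n u d)); [ | apply filterlim_const].
exists d. intros n Hn.
replace n with (d + (n - d))%nat by lia. generalize (n - d)%nat as k. clear n Hn.
induction k as [|k IH]; [now rewrite Nat.add_0_r | ].
rewrite Nat.add_succ_r, sum_Sn, <- IH, H by lia. now rewrite plus_zero_r.
Qed.

Definition is_Cpseries (a : nat -> R) (z l : C) : Prop :=
  is_Cseries (fun n => (RtoC (a n) * z ^ n)%C) l.

Definition summable_at (a : nat -> R) (r : R) : Prop :=
  ex_series (fun n => Rabs (a n) * r ^ n).

Lemma Cmod_Cpseries_term a z n : Cmod (RtoC (a n) * z ^ n)%C = Rabs (a n) * Cmod z ^ n.
Proof. now rewrite Cmod_mult, Cmod_R, Cmod_pow. Qed.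

Lemma summable_at_Cmod a z :
  summable_at a (Cmod z) -> ex_series (fun n => Cmod (RtoC (a n) * z ^ n)%C).
Proof. apply ex_series_ext; intros n; now rewrite Cmod_Cpseries_term. Qed.

Lemma summable_at_le a b r :
  0 <= r -> (forall n, Rabs (a n) <= Rabs (b n)) -> summable_at b r -> summable_at a r.
Proof.
intros Hr Hab. apply (ex_series_le (V := R_CompleteNormedModule)). intros n.
change (Rabs (Rabs (a n) * r ^ n) <= Rabs (b n) * r ^ n).
rewrite Rabs_mult, Rabs_Rabsolu, (Rabs_pos_eq (r ^ n)) by now apply pow_le.
apply Rmult_le_compat_r; [now apply pow_le | apply Hab].
Qed.

(** Abel's lemma; [s] may be the radius of convergence itself. *)
Lemma summable_at_of_bounded a M s r :
  (forall n, Rabs (a n * s ^ n) <= M) -> 0 <= r < s -> summable_at a r.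
Proof.
intros HM [Hr Hrs].
assert (Hin : Rbar_lt (Rabs r) (CV_radius a)).
{ apply (Rbar_lt_le_trans _ s); [rewrite Rabs_pos_eq; assumption | ].
  apply (proj1 (CV_radius_bounded a)). now exists M. }
apply (ex_series_ext (fun n => Rabs (a n * r ^ n))); [ | now apply CV_disk_inside].
intros n. now rewrite Rabs_mult, (Rabs_pos_eq (r ^ n)) by now apply pow_le.
Qed.

Lemma PS_mult_pow a b r n :
  PS_mult (fun k => a k * r ^ k) (fun k => b k * r ^ k) n = PS_mult a b n * r ^ n.
Proof.
unfold PS_mult. rewrite Rmult_comm, scal_sum. apply sum_eq; intros k Hk.
replace n with (k + (n - k))%nat at 4 by lia. rewrite pow_add; ring.
Qed.

Lemma summable_at_PS_mult a b r :
  0 <= r -> summable_at a r -> summable_at b r -> summable_at (PS_mult a b) r.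
Proof.
intros Hr Ha Hb.
assert (Hpos : forall c n, 0 <= Rabs (c n) * r ^ n).
{ intros c n. apply Rmult_le_pos; [apply Rabs_pos | now apply pow_le]. }
assert (Hprod : forall n, 0 <= PS_mult (fun k => Rabs (a k)) (fun k => Rabs (b k)) n).
{ intros n. apply cond_pos_sum; intros k. apply Rmult_le_pos; apply Rabs_pos. }
apply (summable_at_le _ (PS_mult (fun k => Rabs (a k)) (fun k => Rabs (b k)))); [assumption | | ].
- intros n. rewrite (Rabs_pos_eq _ (Hprod n)).
  apply (Rle_trans _ _ _ (Rsum_abs _ _)). apply Req_le, sum_eq; intros k _.
  apply Rabs_mult.
- eexists. eapply is_series_ext; [ | exact (is_series_mult_pos _ _ _ _
    (Series_correct _ Ha) (Series_correct _ Hb) (Hpos a) (Hpos b))].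
  intros n. rewrite (Rabs_pos_eq _ (Hprod n)), <- PS_mult_pow. reflexivity.
Qed.

Lemma ex_Cpseries a z : summable_at a (Cmod z) -> exists l, is_Cpseries a z l.
Proof. intros H. apply ex_Cseries_Cmod, summable_at_Cmod, H. Qed.

Lemma sum_n_RtoC (f : nat -> R) n : sum_n (fun k => RtoC (f k)) n = RtoC (sum_f_R0 f n).
Proof.
induction n as [|n IH]; [now rewrite sum_O | rewrite sum_Sn, IH; simpl].
now rewrite RtoC_plus.
Qed.

Lemma is_Cpseries_PS_mult a b z la lb :
  summable_at a (Cmod z) -> summable_at b (Cmod z) ->
  is_Cpseries a z la -> is_Cpseries b z lb -> is_Cpseries (PS_mult a b) z (la * lb)%C.
Proof.
intros Sa Sb Ha Hb.
eapply (is_series_ext (V := C_NormedModule)); [ | exact (is_Cseries_mult _ _ _ _ Ha Hb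
  (summable_at_Cmod _ _ Sa) (summable_at_Cmod _ _ Sb))].
intros n. unfold PS_mult. rewrite <- sum_n_RtoC.
rewrite <- (sum_n_mult_r (K := C_Ring) (z ^ n)%C).
apply sum_n_ext_loc; intros k Hk.
replace (z ^ n)%C with (z ^ k * z ^ (n - k))%C by (rewrite <- Cpow_add_r; f_equal; lia).
rewrite RtoC_mult.
match goal with |- ?x = mult ?y ?w => change (@eq C x (y * w)%C) end. ring.
Qed.

(** * The series of psi1 on the disk of radius 2 pi *)

Lemma summable_at_phi1_coef r : 0 <= r -> summable_at phi1_coef r.
Proof.
intros Hr. apply (summable_at_le _ (fun n => / INR (fact n))); [assumption | | ].
- intros n. unfold phi1_coef.
  rewrite !Rabs_pos_eq by (left; apply Rinv_0_lt_compat, INR_fact_lt_0).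
  apply Rinv_le_contravar; [apply INR_fact_lt_0 | apply le_INR, fact_le; lia].
- exists (exp r). eapply is_series_ext; [ | exact (is_exp_Reals r)].
  intros n. rewrite Rabs_pos_eq by (left; apply Rinv_0_lt_compat, INR_fact_lt_0).
  rewrite pow_n_pow. apply Rmult_comm.
Qed.

Lemma is_Cpseries_phi1 z : is_Cpseries phi1_coef z (phi1 z).
Proof.
destruct (ex_Cpseries phi1_coef z) as [l Hl].
{ apply summable_at_phi1_coef, Cmod_ge_0. }
replace (phi1 z) with l; [assumption | ].
symmetry. apply CSeries_unique.
refine (is_series_ext _ _ _ _ Hl). intros n. unfold phi1_coef.
rewrite RtoC_inv by apply INR_fact_neq_0. unfold Cdiv.
apply Cmult_comm.
Qed.

(** The nonvanishing of [phi1] on the disk comes for free: the sum of the convergent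
    series is an explicit inverse. *)
Lemma bernoulli_series z :
  Cmod z < 2 * PI ->
  phi1 z <> 0 /\ is_Cpseries (fun n => bernoulli_poly n 0) z (psi1 z).
Proof.
intros Hz. destruct bernoulli_poly_0_bounded as [M HM].
assert (Hs : summable_at (fun n => bernoulli_poly n 0) (Cmod z)).
{ apply (summable_at_of_bounded _ M (2 * PI)); [assumption | ].
  split; [apply Cmod_ge_0 | assumption]. }
destruct (ex_Cpseries _ _ Hs) as [S HS].
assert (E : (phi1 z * S)%C = 1).
{ assert (H := is_Cpseries_PS_mult _ _ _ _ _
    (summable_at_phi1_coef _ (Cmod_ge_0 z)) Hs (is_Cpseries_phi1 z) HS).
  assert (H1 : is_Cpseries (PS_mult phi1_coef (fun k => bernoulli_poly k 0)) z
    (sum_n (fun n => (RtoC (PS_mult phi1_coef (fun k => bernoulli_poly k 0) n) * z ^ n)%C) 0)).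
  { apply (is_series_eventually_0 (V := C_NormedModule)). intros [|n] Hn; [lia | ].
    rewrite PS_mult_phi1_bernoulli. apply Cmult_0_l. }
  rewrite (is_Cseries_unique _ _ _ H H1), sum_O, PS_mult_phi1_bernoulli. simpl. ring. }
assert (Hphi : phi1 z <> 0).
{ intros H0. rewrite H0, Cmult_0_l in E. apply C1_nz. now symmetry. }
split; [assumption | ].
replace (psi1 z) with S; [assumption | ].
unfold psi1. rewrite <- E. field. assumption.
Qed.

Definition bernoulli_coef (n : nat) : R := bernoulli n / INR (fact n).

(** The Bernoulli numbers are chosen by an [epsilon], so their defining property
    has to be supported by a witness. *)
Lemma is_Cpseries_psi1 z : Cmod z < 2 * PI -> is_Cpseries bernoulli_coef z (psi1 z).
Proof.
assert (H : is_bernoulli bernoulli).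
{ apply (epsilon_spec (inhabits (fun _ : nat => 0)) is_bernoulli).
  exists (fun n => bernoulli_poly n 0 * INR (fact n)). intros w Hw.
  refine (is_series_ext _ _ _ _ (proj2 (bernoulli_series w Hw))).
  intros n. assert (RtoC (INR (fact n)) <> 0).
  { intros E. apply RtoC_inj in E. now apply INR_fact_neq_0 in E. }
  rewrite RtoC_mult. cbv beta.
  match goal with |- ?x = ?y => change (@eq C x y) end. field. assumption. }
intros Hz. refine (is_series_ext _ _ _ _ (H z Hz)).
intros n. unfold bernoulli_coef. rewrite RtoC_div by apply INR_fact_neq_0.
match goal with |- ?x = ?y => change (@eq C x y) end. unfold Cdiv. ring.
Qed.

(** Convergence at a real point strictly between [r] and [2 pi] bounds the terms
    there, which gives absolute summability at [r]. *)
Lemma summable_at_bernoulli_coef r : 0 <= r < 2 * PI -> summable_at bernoulli_coef r.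
Proof.
intros Hr. set (s := (r + 2 * PI) / 2).
assert (Hs : is_Cpseries bernoulli_coef s (psi1 s)).
{ apply is_Cpseries_psi1. rewrite Cmod_R, Rabs_pos_eq; unfold s; lra. }
apply is_Cseries_Re_Im in Hs as [Hs _].
destruct (filterlim_bounded (V := R_NormedModule) (fun n => bernoulli_coef n * s ^ n)) as [M HM].
{ exists 0. apply (ex_series_lim_0 (fun n => bernoulli_coef n * s ^ n)).
  eexists. refine (is_series_ext _ _ _ _ Hs).
  intros n. rewrite <- RtoC_pow, <- RtoC_mult. reflexivity. }
apply (summable_at_of_bounded _ M s); [exact HM | unfold s; lra].
Qed.

(** * The binomial identity *)

(** [Binomial.C n k] is not [0] for [k > n], since its subtraction truncates; with
    the value [0] there, Pascal's rule holds for all indices. *)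
Definition choose (n k : nat) : R := if Nat.leb k n then Binomial.C n k else 0.

Lemma choose_le n k : (k <= n)%nat -> choose n k = Binomial.C n k.
Proof. intros H. unfold choose. now rewrite (proj2 (Nat.leb_le _ _) H). Qed.

Lemma choose_gt n k : (n < k)%nat -> choose n k = 0.
Proof. intros H. unfold choose. now rewrite (proj2 (Nat.leb_gt _ _) H). Qed.

Lemma choose_0_r n : choose n 0 = 1.
Proof. rewrite choose_le by lia. apply C_n_0. Qed.

Lemma choose_diag n : choose n n = 1.
Proof. rewrite choose_le by lia. apply C_n_n. Qed.

Lemma choose_pascal n k : choose (S n) (S k) = choose n k + choose n (S k).
Proof.
destruct (Nat.lt_trichotomy k n) as [H | [-> | H]].
- rewrite !choose_le by lia. symmetry. now apply pascal.
- rewrite !choose_diag, choose_gt by lia. ring.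
- rewrite !choose_gt by lia. ring.
Qed.

(** Coefficients of [(1 - t)^N]. *)
Definition binom_pos (N j : nat) : R := (-1) ^ j * choose N j.
(** Coefficients of [(1 - t)^-(m+1)]. *)
Definition binom_neg (m i : nat) : R := choose (m + i) i.

(** Multiplication by [1 - t]. *)
Lemma PS_mult_binom_pos_S N b n :
  PS_mult (binom_pos (S N)) b (S n) = PS_mult (binom_pos N) b (S n) - PS_mult (binom_pos N) b n.
Proof.
unfold PS_mult. rewrite !(decomp_sum _ (S n)) by lia. simpl Init.Nat.pred.
unfold binom_pos at 1 3. rewrite !choose_0_r.
match goal with |- ?x + ?s = ?x + ?t - ?u => cut (s = t - u); [lra | ] end.
rewrite <- minus_sum. apply sum_eq; intros j _.
unfold binom_pos. rewrite choose_pascal. replace (S n - S j)%nat with (n - j)%nat by lia.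
simpl; ring.
Qed.

(** Also multiplication by [1 - t], now of the second factor. *)
Lemma PS_mult_binom_neg_S a m n :
  PS_mult a (binom_neg (S m)) (S n) = PS_mult a (binom_neg m) (S n) + PS_mult a (binom_neg (S m)) n.
Proof.
unfold PS_mult. rewrite !(tech5 _ n). rewrite Nat.sub_diag. unfold binom_neg at 2 4.
rewrite !choose_0_r.
match goal with |- ?s + ?x = ?t + ?x + ?u => cut (s = t + u); [lra | ] end.
rewrite <- sum_plus. apply sum_eq; intros j Hj.
replace (S n - j)%nat with (S (n - j)) by lia. unfold binom_neg.
replace (S m + S (n - j))%nat with (S (m + S (n - j))) by lia.
rewrite choose_pascal. replace (S m + (n - j))%nat with (m + S (n - j))%nat by lia. ring.
Qed.

(** The coefficient of [t^n] in [(1 - t)^(m+1+p) (1 - t)^-(m+1) = (1 - t)^p]. *)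
Lemma PS_mult_binom p m n :
  PS_mult (binom_pos (m + S p)) (binom_neg m) n = (-1) ^ n * choose p n.
Proof.
induction m as [|m IHm].
- assert (Hsum : forall a k, PS_mult a (binom_neg 0) k = sum_f_R0 a k).
  { intros a k. apply sum_eq; intros j _. unfold binom_neg.
    rewrite Nat.add_0_l, choose_diag. ring. }
  simpl (0 + S p)%nat. destruct n as [|n].
  + rewrite Hsum. unfold binom_pos; simpl. rewrite !choose_0_r. ring.
  + rewrite PS_mult_binom_pos_S, !Hsum. simpl sum_f_R0. unfold binom_pos. ring.
- simpl (S m + S p)%nat. rewrite <- IHm. destruct n as [|n].
  + unfold PS_mult, binom_pos, binom_neg; simpl. rewrite !choose_0_r. ring.
  + rewrite PS_mult_binom_pos_S, PS_mult_binom_neg_S. ring.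
Qed.

(** * The Padé remainder *)

Lemma sum_f_R0_truncate (f : nat -> R) k n :
  (k <= n)%nat -> (forall j, (k < j <= n)%nat -> f j = 0) -> sum_f_R0 f n = sum_f_R0 f k.
Proof.
intros Hkn. induction Hkn as [|n Hkn IH]; intros Hf; [reflexivity | simpl].
rewrite IH, Hf by (try intros; try apply Hf; lia). ring.
Qed.

(** Extended by [0] above [d], so that the numerator, a polynomial, can enter Cauchy
    products as a power series. *)
Definition pade_num_coef (d j : nat) : R :=
  if Nat.leb j d
  then INR (fact (2 * d + 1 - j)) * (-1) ^ j / (INR (fact j) * INR (fact (d - j)))
  else 0.

Lemma PS_mult_num_phi1_low d i :
  (i <= d)%nat -> PS_mult (pade_num_coef d) phi1_coef i = pade_den_coef d i.
Proof.
intros Hi. unfold pade_den_coef. rewrite sum_n_Reals. apply sum_eq; intros j Hj.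
unfold pade_num_coef, phi1_coef. rewrite (proj2 (Nat.leb_le j d)) by lia.
replace (i - j + 1)%nat with (1 + i - j)%nat by lia.
field. repeat split; apply INR_fact_neq_0.
Qed.

(** After factoring out [(d+1)! / (i+1)!] the sum is the coefficient of [t^d] in
    [(1 - t)^(i+1) (1 - t)^-(d+2)]. *)
Lemma PS_mult_num_phi1_high d i :
  (d < i)%nat ->
  PS_mult (pade_num_coef d) phi1_coef i =
  INR (fact (d + 1)) / INR (fact (i + 1)) * ((-1) ^ d * choose (i - d - 1) d).
Proof.
intros Hi. rewrite <- (PS_mult_binom _ (d + 1)).
replace (d + 1 + S (i - d - 1))%nat with (i + 1)%nat by lia.
unfold PS_mult. rewrite (sum_f_R0_truncate _ d i) by
  (try lia; intros j Hj; unfold pade_num_coef;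
   rewrite (proj2 (Nat.leb_gt j d)) by lia; ring).
rewrite scal_sum. apply sum_eq; intros j Hj.
unfold pade_num_coef, phi1_coef, binom_pos, binom_neg.
rewrite (proj2 (Nat.leb_le j d)), !choose_le by lia. unfold Binomial.C.
replace (d + 1 + (d - j) - (d - j))%nat with (d + 1)%nat by lia.
replace (d + 1 + (d - j))%nat with (2 * d + 1 - j)%nat by lia.
replace (i - j + 1)%nat with (i + 1 - j)%nat by lia.
field. repeat split; apply INR_fact_neq_0.
Qed.

Definition pade_rem_coef (d i : nat) : R :=
  if Nat.leb i d then 0 else PS_mult (pade_num_coef d) phi1_coef i.

(** The gap between [d] and [2 d] is what makes the approximant one of Padé: there
    [binom (i-d-1) d] has its upper index below its lower one. *)
Lemma pade_rem_coef_0 d i : (i <= 2 * d)%nat -> pade_rem_coef d i = 0.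
Proof.
intros Hi. unfold pade_rem_coef. destruct (Nat.leb_spec i d) as [|H]; [reflexivity | ].
rewrite PS_mult_num_phi1_high, choose_gt by lia. ring.
Qed.

Lemma PS_mult_bernoulli_rem_low d i :
  (i <= 2 * d)%nat -> PS_mult bernoulli_coef (pade_rem_coef d) i = 0.
Proof.
intros Hi. apply sum_eq_R0; intros m Hm. rewrite pade_rem_coef_0 by lia. ring.
Qed.

Lemma PS_mult_bernoulli_rem_high d k :
  Rabs (PS_mult bernoulli_coef (pade_rem_coef d) (2 * d + 1 + k)) = gamma d (2 * d + 1 + k).
Proof.
unfold gamma. rewrite sum_n_Reals.
replace (2 * d + 1 + k - 2 * d - 1)%nat with k by lia.
unfold PS_mult. rewrite (sum_f_R0_truncate _ k) by
  (try lia; intros m Hm; rewrite pade_rem_coef_0 by lia; ring).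
match goal with |- Rabs ?x = Rabs ?y => cut (x = (-1) ^ d * y) end.
{ intros E. rewrite E, Rabs_mult, pow_1_abs. ring. }
rewrite scal_sum. apply sum_eq; intros m Hm.
unfold bernoulli_coef, pade_rem_coef. rewrite (proj2 (Nat.leb_gt _ d)) by lia.
rewrite PS_mult_num_phi1_high, choose_le by lia.
replace (2 * d + 1 + k - m - d - 1)%nat with (2 * d + 1 + k - m - (d + 1))%nat by lia.
replace (2 * d + 1 + k - m + 1)%nat with (1 + (2 * d + 1 + k) - m)%nat by lia.
field. split; apply INR_fact_neq_0.
Qed.

Lemma is_Cpseries_poly (a : nat -> R) d z :
  (forall n, (d < n)%nat -> a n = 0) ->
  is_Cpseries a z (sum_n (fun n => (RtoC (a n) * z ^ n)%C) d).
Proof.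
intros Ha. apply (is_series_eventually_0 (V := C_NormedModule)).
intros n Hn. rewrite Ha by assumption. apply Cmult_0_l.
Qed.

Lemma pade_num_coef_eq d z :
  pade_num d z = (RtoC (INR (fact d) / INR (fact (2 * d + 1)))
                  * sum_n (fun n => (RtoC (pade_num_coef d n) * z ^ n)%C) d)%C.
Proof.
unfold pade_num. f_equal. apply sum_n_ext_loc; intros n Hn.
unfold pade_num_coef. rewrite (proj2 (Nat.leb_le _ _) Hn).
replace (- z)%C with (RtoC (-1) * z)%C by ring.
rewrite Cpow_mult_l, <- RtoC_pow, Cmult_assoc, <- RtoC_mult. do 2 f_equal.
field. split; apply INR_fact_neq_0.
Qed.

Lemma summable_at_pade_num_coef d r : 0 <= r -> summable_at (pade_num_coef d) r.
Proof.
intros Hr. eexists. apply (is_series_eventually_0 (V := R_NormedModule) _ d).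
intros n Hn. unfold pade_num_coef. rewrite (proj2 (Nat.leb_gt _ _) Hn), Rabs_R0.
apply Rmult_0_l.
Qed.

Lemma summable_at_pade_rem_coef d r : 0 <= r -> summable_at (pade_rem_coef d) r.
Proof.
intros Hr. apply (summable_at_le _ (PS_mult (pade_num_coef d) phi1_coef)); [assumption | | ].
- intros n. unfold pade_rem_coef. destruct (Nat.leb n d); [ | apply Rle_refl].
  rewrite Rabs_R0. apply Rabs_pos.
- apply summable_at_PS_mult; [assumption | now apply summable_at_pade_num_coef | ].
  now apply summable_at_phi1_coef.
Qed.

(** [psi1 D - N = - psi1 (N phi1 - D)], and [N phi1 - D] is the tail of [N phi1]. *)
Lemma pade_remainder d z :
  Cmod z < 2 * PI ->
  exists w, is_Cpseries (PS_mult bernoulli_coef (pade_rem_coef d)) z w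
    /\ (psi1 z * pade_den d z - pade_num d z)%C
       = (- (RtoC (INR (fact d) / INR (fact (2 * d + 1))) * w))%C.
Proof.
intros Hz. assert (H0 := Cmod_ge_0 z).
set (N := sum_n (fun n => (RtoC (pade_num_coef d n) * z ^ n)%C) d).
set (D := sum_n (fun n => (RtoC (pade_den_coef d n) * z ^ n)%C) d).
assert (HN : is_Cpseries (pade_num_coef d) z N).
{ apply is_Cpseries_poly. intros n Hn. unfold pade_num_coef.
  now rewrite (proj2 (Nat.leb_gt _ _) Hn). }
set (trunc := fun n => if Nat.leb n d then pade_den_coef d n else 0).
assert (HD : is_Cpseries trunc z D).
{ replace D with (sum_n (fun n => (RtoC (trunc n) * z ^ n)%C) d).
  - apply is_Cpseries_poly. intros n Hn. unfold trunc.
    now rewrite (proj2 (Nat.leb_gt _ _) Hn).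
  - apply sum_n_ext_loc; intros n Hn. unfold trunc.
    now rewrite (proj2 (Nat.leb_le _ _) Hn). }
assert (HE : is_Cpseries (pade_rem_coef d) z (N * phi1 z - D)%C).
{ assert (HNphi := is_Cpseries_PS_mult _ _ _ _ _ (summable_at_pade_num_coef d _ H0)
    (summable_at_phi1_coef _ H0) HN (is_Cpseries_phi1 z)).
  refine (is_series_ext _ _ _ _ (is_series_minus (V := C_NormedModule) _ _ _ _ HNphi HD)).
  intros n. unfold trunc, pade_rem_coef. destruct (Nat.leb_spec n d) as [Hn | Hn].
  - rewrite PS_mult_num_phi1_low by assumption. rewrite Cmult_0_l.
    apply (plus_opp_r (G := C_AbelianGroup)).
  - match goal with |- plus ?x (opp ?y) = ?u => change (@eq C (x - y)%C u) end. ring. }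
exists (psi1 z * (N * phi1 z - D))%C. split.
- apply is_Cpseries_PS_mult; [ | | now apply is_Cpseries_psi1 | exact HE].
  + apply summable_at_bernoulli_coef. now split.
  + now apply summable_at_pade_rem_coef.
- rewrite pade_num_coef_eq. unfold pade_den. fold N D. unfold psi1.
  field. now apply bernoulli_series.
Qed.

Lemma Series_from (c : nat -> R) (n : nat) :
  ex_series c -> (forall k, (k < n)%nat -> c k = 0) ->
  Series c = Series (fun k => c (n + k)%nat).
Proof.
intros Hc Hz. destruct n as [|n]; [reflexivity | ].
rewrite (Series_incr_n c (S n)), sum_eq_R0 by (try assumption; try lia; intros; apply Hz; simpl in *; lia).
apply Rplus_0_l.
Qed.

Theorem theorem2p2 (d : nat) (z : C) (r : R)
    (hzr : Cmod z <= r) (hr : r < 2 * PI) :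
  let tail := fun k : nat =>
    gamma d (2 * d + 1 + k) * r ^ (2 * d + 1 + k) in
  ex_series tail /\
  Cmod (psi1 z * pade_den d z - pade_num d z)%C
    <= INR (fact d) / INR (fact (2 * d + 1)) * Series tail.
Proof.
intros tail. assert (H0 := Cmod_ge_0 z).
set (c := PS_mult bernoulli_coef (pade_rem_coef d)).
assert (Hc : summable_at c r).
{ apply summable_at_PS_mult; [lra | apply summable_at_bernoulli_coef; lra | ].
  apply summable_at_pade_rem_coef; lra. }
assert (Htail : forall k, Rabs (c (2 * d + 1 + k)%nat) * r ^ (2 * d + 1 + k) = tail k).
{ intros k. unfold c, tail. now rewrite PS_mult_bernoulli_rem_high. }
split.
- apply (ex_series_ext _ _ Htail).
  apply (ex_series_incr_n (fun n => Rabs (c n) * r ^ n)), Hc.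
- destruct (pade_remainder d z) as [w [Hw E]]; [lra | ].
  assert (Hpos : 0 < INR (fact d) / INR (fact (2 * d + 1))).
  { apply Rdiv_lt_0_compat; apply INR_fact_lt_0. }
  rewrite E, Cmod_opp, Cmod_mult, Cmod_R, Rabs_pos_eq by lra.
  apply Rmult_le_compat_l; [lra | ].
  rewrite <- (Series_ext _ _ Htail).
  rewrite <- (Series_from (fun n => Rabs (c n) * r ^ n)); [ | exact Hc | ].
  + apply (Cmod_le_Series _ _ _ Hw Hc). intros n. rewrite Cmod_Cpseries_term.
    apply Rmult_le_compat_l; [apply Rabs_pos | now apply pow_incr].
  + intros k Hk. unfold c. rewrite PS_mult_bernoulli_rem_low by lia.
    rewrite Rabs_R0. apply Rmult_0_l.
Qed.
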